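(* Let $u\in\mathcal{M}$, let $f$ be a smooth real-valued function in a neighborhood of $u$ in $\mathbb{R}^N$, and let $g$ and $H$ be the Euclidean gradient and Euclidean Hessian of $f$, respectively. For every tangent vector $\xi\in T_u\mathcal{M}$, the Riemannian Hessian of $f$ (restricted to $\mathcal{M}$) at $u$ satisfies $$\mathrm{Hess}f(u)[\xi]=h_e-\alpha_g\,\xi-\beta_g\,\Gamma\xi-\frac{(u^T\Gamma^2u)(u^Th_e)-M\beta_u}{\alpha_u}\,u+\frac{M\,u^Th_e-\beta_u}{\alpha_u}\,\Gamma u,$$ where, with $g=g(u)$, $$\alpha_g:=\Big(1+\frac{M^2}{\alpha_u}\Big)u^Tg-\frac{M}{\alpha_u}u^T\Gamma g,\qquad \beta_g:=-\frac{M}{\alpha_u}u^Tg+\frac{1}{\alpha_u}u^T\Gamma g,$$ and $h_e:=H(u)\xi$, $\alpha_u:=u^T\Gamma^2u-M^2$, $\beta_u:=u^T\Gamma h_e-\beta_g\,u^T\Gamma^2\xi$.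
   Context: Let $F\ge 1$ be an integer, $n$ a positive even integer, $N=2n(2F+1)$, and let $M$ be a real number with $0\le M<F$ and $M\notin\mathbb{Z}$. Vectors $u\in\mathbb{R}^N$ are written in blocks $u=(u_F;u_{F-1};\dots;u_{-F})$ with $u_l\in\mathbb{R}^{2n}$. Let $\Gamma=\mathrm{diag}(F I_{2n},(F-1)I_{2n},\dots,I_{2n},0,-I_{2n},\dots,-F I_{2n})\in\mathbb{R}^{N\times N}$, so that $(\Gamma u)_l=l\,u_l$. Define $$\mathcal{M}=\{u\in\mathbb{R}^N : u^Tu=1,\ u^T\Gamma u=M\},$$ which is a closed embedded submanifold of $\mathbb{R}^N$ of dimension $N-2$, with tangent space $T_u\mathcal{M}=\{\xi\in\mathbb{R}^N : u^T\xi=0,\ u^T\Gamma\xi=0\}$, equipped with the Riemannian metric $\langle\xi,\zeta\rangle_u=\xi^T\zeta$ induced from $\mathbb{R}^N$. The Riemannian gradient is $\mathrm{grad}f(u)=\mathrm{P}_u\nabla f(u)$, where $\mathrm{P}_u$ is the orthogonal projection of $\mathbb{R}^N$ onto $T_u\mathcal{M}$. The Riemannian Hessian $\mathrm{Hess}f(u):T_u\mathcal{M}\to T_u\mathcal{M}$ is defined by $\mathrm{Hess}f(u)[\xi_u]=(\widetilde\nabla_\xi\,\mathrm{grad}f)(u)$, where $\widetilde\nabla$ is the Riemannian (Levi-Civita) connection of $\mathcal{M}$ and $\xi$ is a smooth vector field with value $\xi_u$ at $u$; since $\mathcal{M}$ is a Riemannian submanifold of $\mathbb{R}^N$, this equals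 $\mathrm{P}_u(\nabla\,\mathrm{grad}f(u)\cdot\xi_u)$, i.e. $\mathrm{P}_u$ applied to the directional derivative of $\mathrm{grad}f$ at $u$ along $\xi_u$. *)

(* Defs.v *)
From HB Require Import structures.
From mathcomp Require Export all_boot all_order all_algebra.
From mathcomp Require Export all_classical all_reals all_analysis.

Set Implicit Arguments.
Unset Strict Implicit.
Unset Printing Implicit Defensive.

Export Order.TTheory GRing.Theory Num.Theory numFieldNormedType.Exports.

Global Open Scope classical_set_scope.
Global Open Scope ring_scope.

Definition dot (R : realType) (N : nat) (u v : 'cV[R]_N) : R :=
  (u^T *m v) ord0 ord0.

(* C^k on O, for O open: a C^(k+1) function is a differentiable one all of
   whose directional derivatives are C^k.  The values of f outside O play no
   role. *)
Fixpoint Ck (R : realType) (V W : normedModType R) (k : nat) (O : set V)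
    (f : V -> W) : Prop :=
  if k is k'.+1 then
    (forall x, O x -> differentiable f x) /\
    (forall v, Ck k' O (fun x => 'D_v f x))
  else forall x, O x -> {for x, continuous f}.

Definition smooth_on (R : realType) (V W : normedModType R) (O : set V)
  (f : V -> W) : Prop := forall k, Ck k O f.

Section Euclidean.
Variables (R : realType) (N : nat).
Implicit Type f : 'cV[R]_N -> R.

Definition egrad f (x : 'cV[R]_N) : 'cV[R]_N :=
  \col_i 'D_(delta_mx i ord0) f x.

Definition ehess f (x : 'cV[R]_N) : 'M[R]_N :=
  \matrix_(i, j) 'D_(delta_mx j ord0) (fun y => 'D_(delta_mx i ord0) f y) x.

(* Orthogonal projection of v onto the linear subspace T: the p in T such that
   v - p is orthogonal to T. *)
Definition orth_proj (T : set 'cV[R]_N) (v : 'cV[R]_N) : 'cV[R]_N :=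
  get [set p | T p /\ forall t, T t -> dot (v - p) t = 0].

End Euclidean.

(* S is an embedded submanifold of R^N, with tangent space T x at each x in S,
   and with the Riemannian metric induced from R^N.  Functions and vector
   fields on S are represented by functions on the ambient space that are
   smooth on some open set containing S; two of them that agree on S represent
   the same object on S. *)
Section Submanifold.
Variables (R : realType) (N : nat).
Local Notation V := 'cV[R]_N.
Variables (S : set V) (T : V -> set V).

Definition smooth_near (W : normedModType R) (h : V -> W) : Prop :=
  exists O : set V, [/\ open O, S `<=` O & smooth_on O h].

Definition vector_field (X : V -> V) : Prop :=
  smooth_near X /\ forall x, S x -> T x (X x).

Record affine_connection (nabla : (V -> V) -> (V -> V) -> V -> V) : Prop := {
  conn_field : forall X Y, vector_field X -> vector_field Y ->
    vector_field (nabla X Y);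
  (* the value on S depends only on the restrictions of X and Y to S *)
  conn_ext : forall X X' Y Y', vector_field X -> vector_field X' ->
    vector_field Y -> vector_field Y' ->
    {in S, X =1 X'} -> {in S, Y =1 Y'} ->
    {in S, nabla X Y =1 nabla X' Y'};
  conn_linl : forall (a b : V -> R) X X' Y, smooth_near a -> smooth_near b ->
    vector_field X -> vector_field X' -> vector_field Y ->
    forall x, S x ->
    nabla (fun y => a y *: X y + b y *: X' y) Y x =
    a x *: nabla X Y x + b x *: nabla X' Y x;
  conn_addr : forall X Y Y', vector_field X ->
    vector_field Y -> vector_field Y' ->
    forall x, S x ->
    nabla X (fun y => Y y + Y' y) x = nabla X Y x + nabla X Y' x;
  conn_leibniz : forall (a : V -> R) X Y, smooth_near a ->
    vector_field X -> vector_field Y ->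
    forall x, S x ->
    nabla X (fun y => a y *: Y y) x =
    a x *: nabla X Y x + 'D_(X x) a x *: Y x
}.

Record levi_civita (nabla : (V -> V) -> (V -> V) -> V -> V) : Prop := {
  lc_connection : affine_connection nabla;
  (* the right-hand side is the Lie bracket [X, Y] *)
  lc_torsion_free : forall X Y, vector_field X -> vector_field Y ->
    forall x, S x ->
    nabla X Y x - nabla Y X x = 'D_(X x) Y x - 'D_(Y x) X x;
  lc_metric : forall X Y Z,
    vector_field X -> vector_field Y -> vector_field Z ->
    forall x, S x ->
    'D_(Z x) (fun y => dot (X y) (Y y)) x =
    dot (nabla Z X x) (Y x) + dot (X x) (nabla Z Y x)
}.

Definition rgrad (f : V -> R) (x : V) : V := orth_proj (T x) (egrad f x).

(* Hess f(u)[X u] = (nabla_X grad f)(u) *)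
Definition rhess (nabla : (V -> V) -> (V -> V) -> V -> V) (f : V -> R)
  (u : V) (X : V -> V) : V := nabla X (rgrad f) u.

End Submanifold.

Section Spinor.
Variables (R : realType) (F n : nat).

Definition dimN : nat := (2 * n * (2 * F + 1))%N.

(* The coordinates with i %/ (2 * n) = k form the (k+1)-th block of length
   2 * n from the top, i.e. the block u_l with l = F - k. *)
Definition Gam : 'M[R]_dimN :=
  diag_mx (\row_(i < dimN) (F%:R - (i %/ (2 * n))%N%:R)).

Definition manifold (M : R) : set 'cV[R]_dimN :=
  [set u | dot u u = 1 /\ dot u (Gam *m u) = M].

Definition tangent (u : 'cV[R]_dimN) : set 'cV[R]_dimN :=
  [set xi | dot u xi = 0 /\ dot u (Gam *m xi) = 0].

End Spinor.

(* Main.v *)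
Require Import Defs.
From mathcomp Require Import ring lra.

(** The Levi-Civita connection of a submanifold of Euclidean space is the
    tangential part of the ambient derivative.  Here the connection is only
    known through its axioms, so this is derived from them: let E(X, Y) be the
    difference of the ambient derivative of Y along X and of nabla X Y.  Both
    terms have the same torsion, so E is symmetric; both are compatible with
    the inner product, so <E(X, Y), Z> is skew in Y and Z.  A trilinear form
    that is symmetric in its first two arguments and skew in its last two
    vanishes, hence E(X, Y) is normal, and nabla X Y, being tangent, is the
    orthogonal projection of the ambient derivative
    ([levi_civita_orth_proj]).  The argument needs every tangent vector to be
    the value of a vector field, and the Hessian needs the Riemannian gradient
    to be one.

    Both follow from an explicit formula for the projection.  The tangent space
    at x is the orthogonal of the two vectors x and Gam x, and the projection
    on it is given by Cramer's rule wherever the Gram determinant of these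
    vectors is nonzero ([orth_proj2]); so the projection of a smooth field is
    smooth on the open set where the determinant does not vanish.  On the
    manifold the determinant is alpha, which equals the squared norm of
    Gam u - M u.  If it were zero, then M would be an eigenvalue of Gam, that is
    an integer ([gram_manifold_neq0]).

    Near u the Riemannian gradient is thus g(x) - a(x) x - b(x) Gam x, with a
    and b smooth, a(u) = alpha_g and b(u) = beta_g.  Its derivative along xi is
    h_e - alpha_g xi - beta_g Gam xi up to a combination of u and Gam u.  The
    projection kills that combination, so the derivatives of a and b need not
    be known, and Cramer's rule yields the coefficients of u and Gam u. *)

Set Implicit Arguments.
Unset Strict Implicit.
Unset Printing Implicit Defensive.

(** * Functions of class C^k *)

Section Ck.
Variables (R : realType) (V : normedModType R).

(** The differential of g at x is that of f: the remainder of the first order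
    expansion of g coincides with that of f near x. *)
Lemma near_eq_differentiable (W : normedModType R) (f g : V -> W) x :
  {near x, f =1 g} -> differentiable f x -> differentiable g x.
Proof.
move=> fg df; apply/diff_locallyP.
have E : g \o shift x = cst (g x) + 'd f x +o_ 0 id.
  apply/eqaddoP => e e0.
  move: (diff_locally df) => /eqaddoP /(_ e e0) dfe.
  have fgs : \forall h \near (0:V), f (h + x) = g (h + x).
    move: (fg); rewrite (near_shift 0 x) => fg0.
    by apply: filterS fg0 => h /=; rewrite subr0.
  apply: filterS2 dfe fgs => h dfe fgh.
  have fx := nbhs_singleton fg; move: dfe.
  by rewrite !fctE /= fgh fx.
have dc := diff_continuous df.
by split; rewrite (diff_unique dc E).
Qed.

(** As O is open, f and g have the same derivatives on O; so the class of a
    function on O may be read off any formula valid there. *)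
Lemma Ck_ext (W : normedModType R) k O (f g : V -> W) : open O ->
  (forall x, O x -> f x = g x) -> Ck k O f -> Ck k O g.
Proof.
move=> oO; elim: k f g => [|k IH] f g fg /=.
  move=> cf x Ox; rewrite /prop_for /continuous_at -(fg x Ox).
  apply: cvg_trans (cf x Ox); apply: near_eq_cvg.
  by apply: filterS fg _; exact: open_nbhs_nbhs.
have nfg x : O x -> {near x, f =1 g}.
  by move=> Ox; apply: filterS fg _; exact: open_nbhs_nbhs.
move=> [df dk]; split=> [x Ox|v].
  exact: near_eq_differentiable (nfg x Ox) (df x Ox).
apply: IH (dk v) => x Ox; apply: near_eq_derive; exact: nfg.
Qed.

Lemma Ck_subset (W : normedModType R) k (O O' : set V) (f : V -> W) :
  O' `<=` O -> Ck k O f -> Ck k O' f.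
Proof.
move=> sO; elim: k f => [|k IH] f /=; first by move=> h x /sO /h.
by move=> [df dk]; split=> [x /sO /df//|v]; exact: IH.
Qed.

(** In the Leibniz rule one factor is left undifferentiated, so inductions on k
    for products and inverses need the class of a function to be lowered. *)
Lemma CkS (W : normedModType R) k (O : set V) (f : V -> W) :
  Ck k.+1 O f -> Ck k O f.
Proof.
elim: k f => [|k IH] f [df dk] /=.
  by move=> x /df; exact: differentiable_continuous.
by split=> // v; exact: IH.
Qed.

Lemma Ck_cst (W : normedModType R) k (O : set V) (c : W) : Ck k O (fun=> c).
Proof.
elim: k c => [|k IH] c /=; first by move=> x _; exact: cst_continuous.
split=> [x _|v]; first exact: differentiable_cst.
suff -> : 'D_v (fun=> c) = (fun=> 0) :> (V -> W) by [].
by apply/funext => x; exact: derive_cst.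
Qed.

Section Scalar.
Variables (O : set V) (oO : open O).
Implicit Types f g : V -> R.

Lemma CkD k f g : Ck k O f -> Ck k O g -> Ck k O (fun x => f x + g x).
Proof.
elim: k f g => [|k IH] f g /=.
  by move=> cf cg x Ox; apply: continuousD; [exact: cf|exact: cg].
move=> [df dkf] [dg dkg]; split=> [x Ox|v].
  by apply: differentiableD; [exact: df|exact: dg].
apply: (Ck_ext oO _ (IH _ _ (dkf v) (dkg v))) => x Ox.
by rewrite deriveD//; apply: diff_derivable; [exact: df|exact: dg].
Qed.

Lemma CkM k f g : Ck k O f -> Ck k O g -> Ck k O (fun x => f x * g x).
Proof.
elim: k f g => [|k IH] f g.
  by move=> cf cg x Ox; apply: continuousM; [exact: cf|exact: cg].
move=> Cf Cg; have [df dkf] := Cf; have [dg dkg] := Cg; split=> [x Ox|v].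
  by apply: differentiableM; [exact: df|exact: dg].
apply: (Ck_ext oO _ (CkD (IH _ _ (CkS Cf) (dkg v)) (IH _ _ (CkS Cg) (dkf v)))).
move=> x Ox; rewrite deriveM//; apply: diff_derivable; [exact: df|exact: dg].
Qed.

Lemma CkV k f : (forall x, O x -> f x != 0) -> Ck k O f ->
  Ck k O (fun x => (f x)^-1).
Proof.
move=> f0; elim: k => [|k IH].
  by move=> cf x Ox; apply: continuousV; [exact: f0|exact: cf].
move=> Cf; have [df dkf] := Cf; split=> [x Ox|v].
  by apply: differentiableV; [exact: df|exact: f0].
have CV := IH (CkS Cf).
apply: (Ck_ext oO _ (CkM (CkM (Ck_cst k O (-1 : R)) (CkM CV CV)) (dkf v))).
move=> x Ox.
rewrite deriveV ?f0//; last by apply: diff_derivable; exact: df.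
by rewrite mulN1r -expr2 exprVn.
Qed.

Lemma Ck_sum k n (f : 'I_n -> V -> R) : (forall i, Ck k O (f i)) ->
  Ck k O (fun x => \sum_i f i x).
Proof.
elim: n f => [|n IH] f Cf.
  rewrite (_ : (fun x => _) = fun=> 0); first exact: Ck_cst.
  by apply/funext => x; rewrite big_ord0.
rewrite (_ : (fun x => _) =
    fun x => (\sum_(i < n) f (widen_ord (leqnSn n) i) x) + f ord_max x).
  by apply: CkD => //; apply: IH.
by apply/funext => x; rewrite big_ord_recr.
Qed.

End Scalar.
End Ck.

(** * Inner product and projection on the orthogonal of two vectors *)

Section Dot.
Variables (R : realType) (N : nat).
Implicit Types (u v w : 'cV[R]_N) (A : 'M[R]_N).

Lemma dotE u v : dot u v = \sum_i u i ord0 * v i ord0.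
Proof. by rewrite /dot mxE; apply: eq_bigr => i _; rewrite mxE. Qed.

Lemma dotC u v : dot u v = dot v u.
Proof. by rewrite !dotE; apply: eq_bigr => i _; rewrite mulrC. Qed.

Lemma dot0r u : dot u 0 = 0.
Proof. by rewrite /dot mulmx0 mxE. Qed.

Lemma dotDr u v w : dot u (v + w) = dot u v + dot u w.
Proof. by rewrite /dot mulmxDr mxE. Qed.

Lemma dotBr u v w : dot u (v - w) = dot u v - dot u w.
Proof. by rewrite /dot mulmxBr !mxE. Qed.

Lemma dotZr a u v : dot u (a *: v) = a * dot u v.
Proof. by rewrite /dot -scalemxAr mxE. Qed.

Lemma dotBl u v w : dot (u - v) w = dot u w - dot v w.
Proof. by rewrite ![dot _ w]dotC dotBr. Qed.

Lemma dotZl a u v : dot (a *: u) v = a * dot u v.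
Proof. by rewrite ![dot _ v]dotC dotZr. Qed.

Lemma dot_mulmx A u v : dot (A *m u) v = dot u (A^T *m v).
Proof. by rewrite /dot trmx_mul mulmxA. Qed.

Lemma dot_eq0 u : dot u u = 0 -> u = 0.
Proof.
rewrite dotE => /eqP; rewrite psumr_eq0 => [/allP u0|i _]; last first.
  by rewrite -expr2 sqr_ge0.
apply/matrixP => i j; rewrite (ord1 j) mxE.
by have := u0 i (mem_index_enum _); rewrite -expr2 sqrf_eq0 => /eqP.
Qed.

(** Two candidates for the projection differ by an element of T that is
    orthogonal to T, hence to itself. *)
Lemma orth_proj_eq (T : set 'cV[R]_N) v p :
  (forall s t, T s -> T t -> T (s - t)) ->
  T p -> (forall t, T t -> dot (v - p) t = 0) -> orth_proj T v = p.
Proof.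
move=> TB Tp pv; rewrite /orth_proj; set Q := [set _ | _].
have [Tq qv] : Q (get Q) by apply: (@getI _ _ p).
apply/eqP; rewrite -subr_eq0; apply/eqP/dot_eq0.
have Tqp := TB _ _ Tq Tp.
have := qv _ Tqp; have := pv _ Tqp; rewrite !dotBl; lra.
Qed.

Definition orth2 u v : set 'cV[R]_N := [set t | dot u t = 0 /\ dot v t = 0].

Lemma orth2B u v s t : orth2 u v s -> orth2 u v t -> orth2 u v (s - t).
Proof.
by move=> [s1 s2] [t1 t2]; split; rewrite dotBr ?s1 ?t1 ?s2 ?t2 subr0.
Qed.

Definition gram u v := dot u u * dot v v - dot u v ^+ 2.

(** By Cramer's rule, the coefficient of u in the component of w in the span of
    u and v; the one of v is obtained by exchanging u and v. *)
Definition orth_coef u v w :=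
  (dot v v * dot u w - dot u v * dot v w) / gram u v.

Lemma gramC u v : gram u v = gram v u.
Proof. by rewrite /gram (dotC u v) mulrC. Qed.

Lemma orth2_subr_orth_coef u v w : gram u v != 0 ->
  orth2 u v (w - orth_coef u v w *: u - orth_coef v u w *: v).
Proof.
move=> D0; split; rewrite !dotBr !dotZr /orth_coef (gramC v u) (dotC v u) /gram;
by move: D0; rewrite /gram => D0; field.
Qed.

Lemma orth_proj2 u v w : gram u v != 0 ->
  orth_proj (orth2 u v) w = w - orth_coef u v w *: u - orth_coef v u w *: v.
Proof.
move=> D0; apply: orth_proj_eq; [exact: orth2B|exact: orth2_subr_orth_coef|].
move=> t [ut vt]; rewrite !dotBl !dotZl ut vt; ring.
Qed.

End Dot.

(** * Vector-valued functions of class C^k *)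

Section CkVec.
Variables (R : realType) (V : normedModType R) (N : nat).
Variables (O : set V) (oO : open O).
Implicit Types (f g : V -> 'cV[R]_N) (a : V -> R).

Lemma cV_sum (x : 'cV[R]_N) : x = \sum_i x i ord0 *: delta_mx i ord0.
Proof.
by rewrite [LHS]matrix_sum_delta; apply: eq_bigr => i _; rewrite big_ord1.
Qed.

(** All questions about vector-valued functions are reduced to coordinates, by
    writing a vector as a combination of constant vectors. *)
Lemma differentiable_cV f x :
  (forall i, differentiable (fun y => f y i ord0) x) -> differentiable f x.
Proof.
move=> df.
have -> : f = \sum_i (fun y => f y i ord0 *: delta_mx i ord0).
  by apply/funext => y; rewrite fct_sumE -cV_sum.
by apply: differentiable_sum => i; exact: differentiableZl.
Qed.

Lemma differentiable_coords f i x :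
  differentiable f x -> differentiable (fun y => f y i ord0) x.
Proof.
move=> df.
exact: (differentiable_comp df (differentiable_coord (f x) i ord0)).
Qed.

Lemma derive_coord f i x v : differentiable f x ->
  'D_v (fun y => f y i ord0) x = ('D_v f x) i ord0.
Proof.
by move=> df; rewrite derive_mx; [rewrite mxE|exact: diff_derivable].
Qed.

Lemma Ck_coord k f i : Ck k O f -> Ck k O (fun y => f y i ord0).
Proof.
elim: k f => [|k IH] f /=.
  move=> cf x Ox.
  exact: (continuous_comp (cf x Ox) (@coord_continuous R N 1 i ord0 (f x))).
move=> [df dk]; split=> [x Ox|v].
  by apply: differentiable_coords; exact: df.
apply: (Ck_ext oO _ (IH _ (dk v))) => x Ox.
by rewrite derive_coord//; exact: df.
Qed.

Lemma Ck_cV k f : (forall i, Ck k O (fun y => f y i ord0)) -> Ck k O f.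
Proof.
elim: k f => [|k IH] f Cf.
  move=> x Ox.
  have -> : f = \sum_i (fun y => f y i ord0 *: delta_mx i ord0).
    by apply/funext => y; rewrite fct_sumE -cV_sum.
  elim/big_ind: _ => [|g h cg ch|i _]; first exact: cst_continuous.
    exact: continuousD.
  by apply: continuousZr_tmp; exact: Cf.
have df x : O x -> differentiable f x.
  by move=> Ox; apply: differentiable_cV => i; exact: (Cf i).1.
split=> // v; apply: IH => i.
by apply: (Ck_ext oO _ ((Cf i).2 v)) => x Ox; rewrite derive_coord//; exact: df.
Qed.

Lemma Ck_id k : Ck k O id.
Proof.
case: k => [|k]; first by move=> x _; exact: cvg_id.
split=> [x _|v]; first exact: ex_diff.
suff -> : 'D_v id = (fun=> v) :> (V -> V) by exact: Ck_cst.
by apply/funext => x; exact: derive_id.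
Qed.

Lemma Ck_dot k f g : Ck k O f -> Ck k O g -> Ck k O (fun y => dot (f y) (g y)).
Proof.
move=> Cf Cg.
have -> : (fun y => dot (f y) (g y)) =
    (fun y => \sum_i f y i ord0 * g y i ord0).
  by apply/funext => y; rewrite dotE.
by apply: Ck_sum => // i; apply: CkM => //; exact: Ck_coord.
Qed.

Lemma Ck_mulmx k (A : 'M[R]_N) f : Ck k O f -> Ck k O (fun y => A *m f y).
Proof.
move=> Cf; apply: Ck_cV => i.
have -> : (fun y => (A *m f y) i ord0) = (fun y => \sum_j A i j * f y j ord0).
  by apply/funext => y; rewrite mxE.
by apply: Ck_sum => // j; apply: CkM => //; [exact: Ck_cst|exact: Ck_coord].
Qed.

Lemma Ck_scale k a f : Ck k O a -> Ck k O f -> Ck k O (fun y => a y *: f y).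
Proof.
move=> Ca Cf; apply: Ck_cV => i.
have -> : (fun y => (a y *: f y) i ord0) = (fun y => a y * f y i ord0).
  by apply/funext => y; rewrite mxE.
by apply: CkM => //; exact: Ck_coord.
Qed.

Lemma CkB k f g : Ck k O f -> Ck k O g -> Ck k O (fun y => f y - g y).
Proof.
move=> Cf Cg; apply: Ck_cV => i.
have -> : (fun y => (f y - g y) i ord0) =
    (fun y => f y i ord0 + (-1) * g y i ord0).
  by apply/funext => y; rewrite !mxE mulN1r.
apply: CkD => //; first exact: Ck_coord.
by apply: CkM => //; [exact: Ck_cst|exact: Ck_coord].
Qed.

Lemma derive_dot f g x v : differentiable f x -> differentiable g x ->
  'D_v (fun y => dot (f y) (g y)) x =
  dot ('D_v f x) (g x) + dot (f x) ('D_v g x).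
Proof.
move=> df dg.
have -> : (fun y => dot (f y) (g y)) =
    \sum_i ((fun y => f y i ord0) * (fun y => g y i ord0)).
  by apply/funext => y; rewrite fct_sumE dotE.
rewrite derive_sum => [|i]; last first.
  by apply: derivableM; apply: diff_derivable; exact: differentiable_coords.
rewrite !dotE -big_split /=; apply: eq_bigr => i _.
rewrite deriveM; try by apply: diff_derivable; exact: differentiable_coords.
by rewrite !derive_coord// addrC /GRing.scale /= [_ * g x _ _]mulrC.
Qed.

Lemma is_derive_scale a f x v : differentiable a x -> differentiable f x ->
  is_derive x v (fun y => a y *: f y) ('D_v a x *: f x + a x *: 'D_v f x).
Proof.
move=> da df.
have daf i : differentiable (fun y => (a y *: f y) i ord0) x.
  rewrite (_ : (fun y => _) = a * (fun y => f y i ord0)).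
    by apply: differentiableM => //; exact: differentiable_coords.
  by apply/funext => y; rewrite mxE.
have dd : derivable (fun y => a y *: f y) x v.
  exact: diff_derivable (differentiable_cV daf).
apply: DeriveDef => //; rewrite derive_mx//.
apply/matrixP => i j; rewrite (ord1 j) !mxE.
rewrite (_ : (fun y => _) = a * (fun y => f y i ord0)); last first.
  by apply/funext => y; rewrite mxE.
rewrite deriveM; try by apply: diff_derivable => //;
  exact: differentiable_coords.
by rewrite derive_coord// addrC /GRing.scale /= [_ * f x _ _]mulrC.
Qed.

Lemma derive_mulmx (A : 'M[R]_N) f x v : differentiable f x ->
  'D_v (fun y => A *m f y) x = A *m 'D_v f x.
Proof.
move=> df.
have rowE i y : (A *m y) i ord0 = dot (row i A)^T y.
  by rewrite dotE mxE; apply: eq_bigr => j _; rewrite !mxE.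
have dA i : differentiable (fun y => (A *m f y) i ord0) x.
  have -> : (fun y => (A *m f y) i ord0) =
      \sum_j (A i j *: (fun y => f y j ord0)).
    by apply/funext => y; rewrite fct_sumE mxE.
  apply: differentiable_sum => j; apply: differentiableZ.
  exact: differentiable_coords.
rewrite derive_mx; last exact: diff_derivable (differentiable_cV dA).
apply/matrixP => i j; rewrite (ord1 j) !mxE.
rewrite (_ : (fun y => _) = (fun y => dot (row i A)^T (f y))); last first.
  by apply/funext => y; rewrite rowE.
rewrite (derive_dot _ (differentiable_cst _ _) df) derive_cst.
by rewrite dotC dot0r add0r -rowE mxE.
Qed.

End CkVec.

(** * The Levi-Civita connection of a Euclidean submanifold *)

Section LeviCivita.
Variables (R : realType) (N : nat).
Local Notation V := 'cV[R]_N.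
Variables (S : set V) (T : V -> set V).

Lemma vector_field_differentiable (X : V -> V) x :
  vector_field S T X -> S x -> differentiable X x.
Proof. by move=> [[B [_ SB sX]] _] Sx; apply: (sX 1%N).1; exact: SB. Qed.

(** The uniqueness half of the fundamental theorem of Riemannian geometry, at a
    point: the fields Z extending the tangent vectors t test the difference of
    the two derivatives against every direction of T x. *)
Lemma levi_civita_orth_proj (nabla : (V -> V) -> (V -> V) -> V -> V) X Y x :
  levi_civita S T nabla ->
  (forall s t, T x s -> T x t -> T x (s - t)) ->
  (forall t, T x t -> exists2 Z, vector_field S T Z & Z x = t) ->
  vector_field S T X -> vector_field S T Y -> S x ->
  nabla X Y x = orth_proj (T x) ('D_(X x) Y x).
Proof.
move=> lc TB Text fX fY Sx; apply/esym/orth_proj_eq => //.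
  by have [_] := conn_field (lc_connection lc) fX fY; exact.
move=> t /Text [Z fZ <-].
pose E A B := 'D_(A x) B x - nabla A B x.
(* The ambient derivative has the same torsion as nabla. *)
have Esym A B C : vector_field S T A -> vector_field S T B ->
    dot (E A B) (C x) = dot (E B A) (C x).
  move=> fA fB.
  have := congr1 (fun w => dot w (C x)) (lc_torsion_free lc fA fB Sx).
  rewrite /= /E !dotBl; lra.
(* The ambient derivative satisfies the Leibniz rule for dot, as nabla does. *)
have Eskew A B C : vector_field S T A -> vector_field S T B ->
    vector_field S T C -> dot (E C A) (B x) = - dot (E C B) (A x).
  move=> fA fB fC; have := lc_metric lc fA fB fC Sx.
  rewrite derive_dot; try exact: vector_field_differentiable.
  rewrite /E !dotBl (dotC (A x)) (dotC (A x) (nabla _ _ _)); lra.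
rewrite -/(E X Y).
(* Six alternate exchanges bring (X, Y, Z) back to itself with three changes
   of sign, so <E(X, Y), Z> equals its opposite. *)
have h1 := Esym _ _ Z fX fY; have h2 := Eskew _ _ _ fX fZ fY.
have h3 := Esym _ _ X fY fZ; have h4 := Eskew _ _ _ fY fX fZ.
have h5 := Esym _ _ Y fZ fX; have h6 := Eskew _ _ _ fZ fY fX.
lra.
Qed.
End LeviCivita.

(** * Euclidean gradient and smoothness of the projection *)

Section Euclid.
Variables (R : realType) (N : nat).
Local Notation V := 'cV[R]_N.

Lemma derive_partials (h : V -> R) x xi : differentiable h x ->
  'D_xi h x = \sum_j 'D_(delta_mx j ord0) h x * xi j ord0.
Proof.
move=> dh; rewrite deriveE// {1}(cV_sum xi) linear_sum.
by apply: eq_bigr => j _; rewrite linearZ deriveE// mulrC.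
Qed.

Lemma Ck_egrad k O (f : V -> R) : open O -> Ck k.+1 O f -> Ck k O (egrad f).
Proof.
move=> oO [_ df]; apply: Ck_cV => // i.
by apply: (Ck_ext oO _ (df (delta_mx i ord0))) => x _; rewrite mxE.
Qed.

(** Entry (i, j) of the Hessian differentiates the i-th partial derivative along
    the j-th direction; so the product with xi sums the partial derivatives of
    each coordinate of the gradient into its derivative along xi. *)
Lemma derive_egrad O (f : V -> R) x xi : open O -> Ck 2 O f -> O x ->
  'D_xi (egrad f) x = ehess f x *m xi.
Proof.
move=> oO C2 Ox; have dg := (Ck_egrad oO C2).1 x Ox.
apply/matrixP => i j; rewrite (ord1 j) -derive_coord// mxE.
have -> : (fun y => egrad f y i ord0) = 'D_(delta_mx i ord0) f.
  by apply/funext => y; rewrite mxE.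
rewrite derive_partials; last exact: (C2.2 _).1.
by apply: eq_bigr => l _; rewrite mxE.
Qed.

Variable A : 'M[R]_N.

(** The projection of v on the orthogonal of x and A x, as a formula in which x
    may vary; for A = Gam it is the projection on the tangent space at x. *)
Definition nproj (v x : V) : V :=
  v - orth_coef x (A *m x) v *: x - orth_coef (A *m x) x v *: (A *m x).

Lemma Ck_gram k O (f g : V -> V) : open O -> Ck k O f -> Ck k O g ->
  Ck k O (fun x => gram (f x) (g x)).
Proof.
move=> oO Cf Cg.
have Cd := fun h h' => @Ck_dot R V N O oO k h h'.
apply: (Ck_ext oO (f := fun x => dot (f x) (f x) * dot (g x) (g x) +
   (-1) * (dot (f x) (g x) * dot (f x) (g x)))) => [x _|].
  by rewrite /gram expr2 mulN1r.
apply: CkD => //; first by apply: CkM => //; exact: Cd.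
by apply: CkM => //; [exact: Ck_cst|apply: CkM => //; exact: Cd].
Qed.

Lemma Ck_orth_coef k O (f g h : V -> V) : open O ->
  (forall x, O x -> gram (f x) (g x) != 0) ->
  Ck k O f -> Ck k O g -> Ck k O h ->
  Ck k O (fun x => orth_coef (f x) (g x) (h x)).
Proof.
move=> oO D0 Cf Cg Ch.
have Cd := fun h h' => @Ck_dot R V N O oO k h h'.
apply: (Ck_ext oO (f := fun x => (dot (g x) (g x) * dot (f x) (h x) +
   (-1) * (dot (f x) (g x) * dot (g x) (h x))) * (gram (f x) (g x))^-1)).
  by move=> x _; rewrite /orth_coef mulN1r.
apply: CkM => //; last by apply: CkV => //; exact: Ck_gram.
apply: CkD => //; first by apply: CkM => //; exact: Cd.
by apply: CkM => //; [exact: Ck_cst|apply: CkM => //; exact: Cd].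
Qed.

Lemma Ck_nproj k O (g : V -> V) : open O ->
  (forall x, O x -> gram x (A *m x) != 0) ->
  Ck k O g -> Ck k O (fun x => nproj (g x) x).
Proof.
move=> oO D0 Cg.
have Cx : Ck k O (fun x : V => x) by exact: Ck_id.
have CA : Ck k O (fun x => A *m x) by exact: Ck_mulmx.
do 2! (apply: CkB => //; last by apply: Ck_scale => //;
  apply: Ck_orth_coef => // x Ox; rewrite 1?gramC D0).
Qed.

End Euclid.

Lemma open_gram (R : realType) N (A : 'M[R]_N) :
  open [set x : 'cV[R]_N | gram x (A *m x) != 0].
Proof.
have C0 : Ck 0 setT (fun x : 'cV[R]_N => gram x (A *m x)).
  have Cx : Ck 0 setT (fun x : 'cV[R]_N => x) by exact: Ck_id.
  have oT : open [set: 'cV[R]_N] by exact: openT.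
  have CA : Ck 0 setT (fun x : 'cV[R]_N => A *m x) by exact: Ck_mulmx.
  exact: (Ck_gram oT Cx CA).
apply: (@open_comp _ _ (fun x => gram x (A *m x)) [set y | y != 0]).
  by move=> x _; exact: (C0 x I).
exact: open_neq.
Qed.

(** * The geometry of the constraint manifold *)

Section Spin.
Variables (R : realType) (F n : nat).
Local Notation G := (Gam R F n).
Local Notation V := 'cV[R]_(dimN F n).

Lemma dot_Gam (u v : V) : dot (G *m u) v = dot u (G *m v).
Proof. by rewrite dot_mulmx tr_diag_mx. Qed.

Lemma tangentE : @tangent R F n = fun u => orth2 u (G *m u).
Proof.
apply/funext => u; apply/seteqP; split=> t [ut Gt]; split => //.
  by rewrite dot_Gam.
by rewrite -dot_Gam.
Qed.

Lemma gram_manifold M (u : V) : manifold M u ->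
  gram u (G *m u) = dot u (G *m (G *m u)) - M ^+ 2.
Proof. by move=> [u1 uM]; rewrite /gram u1 uM mul1r dot_Gam. Qed.

(** The Gram determinant is the squared norm of Gam u - M u, and all the
    eigenvalues of Gam are integers. *)
Lemma gram_manifold_neq0 M (u : V) : M \isn't a Num.int -> manifold M u ->
  gram u (G *m u) != 0.
Proof.
move=> MZ hu; have [u1 uM] := hu; rewrite (gram_manifold hu); apply/eqP => a0.
have /dot_eq0 /subr0_eq eigen : dot (G *m u - M *: u) (G *m u - M *: u) = 0.
  rewrite !dotBl !dotBr !dotZl !dotZr !dot_Gam u1 uM; lra.
have u0 : u = 0.
  apply/matrixP => i j; rewrite (ord1 j) [RHS]mxE; apply/eqP.
  apply: contraNT MZ => ui0.
  have /matrixP/(_ i ord0) := eigen.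
  rewrite mul_diag_mx !mxE => /(mulIf ui0) <-.
  by rewrite rpredB// natr_int.
by move: u1; rewrite u0 dot0r => /esym/eqP; rewrite oner_eq0.
Qed.

End Spin.

(** * The Riemannian Hessian *)

Theorem lemma4p2 (R : realType) (F n : nat) (hF : (1 <= F)%N)
  (hn : (0 < n)%N) (hev : ~~ odd n)
  (M : R) (hM0 : 0 <= M) (hMF : M < F%:R) (hMZ : M \isn't a Num.int)
  (u : 'cV[R]_(dimN F n)) (hu : manifold M u)
  (U : set 'cV[R]_(dimN F n)) (hU : open U) (hUu : U u)
  (f : 'cV[R]_(dimN F n) -> R) (hf : smooth_on U f)
  (* the Levi-Civita connection of the open part of the manifold on which f
     is defined *)
  (nabla : ('cV[R]_(dimN F n) -> 'cV[R]_(dimN F n)) ->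
           ('cV[R]_(dimN F n) -> 'cV[R]_(dimN F n)) ->
           'cV[R]_(dimN F n) -> 'cV[R]_(dimN F n))
  (hnabla : levi_civita (manifold M `&` U) (@tangent R F n) nabla)
  (xi : 'cV[R]_(dimN F n)) (hxi : tangent u xi)
  (X : 'cV[R]_(dimN F n) -> 'cV[R]_(dimN F n))
  (hX : vector_field (manifold M `&` U) (@tangent R F n) X)
  (hXu : X u = xi) :
  let G := Gam R F n in
  let g := egrad f u in
  let he := ehess f u *m xi in
  let uG2u := dot u (G *m (G *m u)) in
  let alpha := uG2u - M ^+ 2 in
  let alphag :=
    (1 + M ^+ 2 / alpha) * dot u g - M / alpha * dot u (G *m g) in
  let betag := - (M / alpha) * dot u g + alpha^-1 * dot u (G *m g) in
  let beta := dot u (G *m he) - betag * dot u (G *m (G *m xi)) in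
  rhess (@tangent R F n) nabla f u X =
    he - alphag *: xi - betag *: (G *m xi)
    - ((uG2u * dot u he - M * beta) / alpha) *: u
    + ((M * dot u he - beta) / alpha) *: (G *m u).
Proof.
move=> G g he uG2u alpha alphag betag beta.
pose S := manifold M `&` U.
pose O := U `&` [set x | gram x (G *m x) != 0].
have oO : open O by apply: openI => //; exact: open_gram.
have SO : S `<=` O.
  by move=> x [Mx Ux]; split=> //; exact: gram_manifold_neq0 Mx.
have O0 x : O x -> gram x (G *m x) != 0 by case.
have Su : S u by [].
have Ou := SO _ Su.
have projE v x : gram x (G *m x) != 0 -> orth_proj (tangent x) v = nproj G v x.
  by move=> D0; rewrite tangentE orth_proj2.
have field_of h : smooth_on O h ->
    vector_field S (@tangent R F n) (fun x => orth_proj (tangent x) (h x)).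
  move=> sh; split.
    exists O; split=> // k; apply: (Ck_ext oO _ (Ck_nproj oO O0 (sh k))).
    by move=> x Ox; rewrite projE// O0.
  move=> x /SO /O0 D0; rewrite tangentE orth_proj2//.
  exact: orth2_subr_orth_coef.
have Cf k : Ck k O f by apply: Ck_subset (hf k) => x [].
have Cg k : Ck k O (egrad f) by apply: Ck_egrad.
rewrite /rhess.
rewrite (levi_civita_orth_proj hnabla _ _ hX (field_of _ Cg) Su); last first.
- move=> t tt; exists (fun x => orth_proj (tangent x) t).
    by apply: (field_of (fun=> t)) => k; exact: Ck_cst.
  apply: orth_proj_eq => // [s s'|s _]; last by rewrite subrr dotC dot0r.
  by rewrite tangentE; exact: orth2B.
- by rewrite tangentE => s s'; exact: orth2B.
set a := fun x => orth_coef x (G *m x) (egrad f x).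
set b := fun x => orth_coef (G *m x) x (egrad f x).
have Cx k : Ck k O (fun x : 'cV[R]_(dimN F n) => x) by exact: Ck_id.
have CG k : Ck k O (fun x => G *m x) by exact: Ck_mulmx.
(* The gradient is now read as egrad f x - a x *: x - b x *: (G *m x). *)
have da : differentiable a u.
  have Ca : Ck 1 O a by exact: Ck_orth_coef.
  exact: Ca.1.
have db : differentiable b u.
  have Cb : Ck 1 O b by apply: Ck_orth_coef => // x Ox; rewrite gramC O0.
  exact: Cb.1.
have dG : differentiable (fun x => G *m x) u by exact: (CG 1%N).1.
have dx : differentiable (fun x : 'cV[R]_(dimN F n) => x) u.
  exact: (Cx 1%N).1.
have dg : differentiable (egrad f) u by exact: (Cg 1%N).1.
(* The derivatives a' and b' stay unevaluated: the projection removes them. *)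
set a' := 'D_xi a u; set b' := 'D_xi b u.
have -> : 'D_(X u) (fun x => orth_proj (tangent x) (egrad f x)) u =
    he - (a' *: u + a u *: xi) - (b' *: (G *m u) + b u *: (G *m xi)).
  rewrite hXu.
  rewrite (near_eq_derive (g := fun x => nproj G (egrad f x) x)); last first.
    apply: filterS (open_nbhs_nbhs (conj oO Ou)) => x Ox.
    by rewrite projE// O0.
  have -> : (fun x => nproj G (egrad f x) x) =
      egrad f - (fun x => a x *: x) - (fun x => b x *: (G *m x)) by [].
  have hg : is_derive u xi (egrad f) he.
    apply: DeriveDef; first exact: diff_derivable.
    exact: derive_egrad (Cf 2%N) Ou.
  have ha : is_derive u xi (fun x => a x *: x) (a' *: u + a u *: xi).
    by have := is_derive_scale xi da dx; rewrite derive_id.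
  have hb : is_derive u xi (fun x => b x *: (G *m x))
      (b' *: (G *m u) + b u *: (G *m xi)).
    by have := is_derive_scale xi db dG; rewrite derive_mulmx// derive_id.
  exact: (@derive_val _ _ _ _ _ _ _ (is_deriveB (is_deriveB hg ha) hb)).
have D0 := O0 _ Ou.
have alpha0 : alpha != 0 by rewrite /alpha /uG2u -gram_manifold.
have [u1 uM] := hu; have [uxi uGxi] := hxi.
rewrite tangentE orth_proj2//.
have -> : alphag = a u.
  rewrite /a /orth_coef (gram_manifold hu) !dot_Gam -/G uM.
  rewrite /alphag -/uG2u -/alpha -/g.
  by rewrite /alpha; field.
have Eb : betag = b u.
  rewrite /b /orth_coef gramC (gram_manifold hu) !dot_Gam -/G uM u1.
  rewrite -/uG2u -/alpha -/g.
  by rewrite /betag /alpha; field.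
rewrite -Eb.
set w := he - (a' *: u + a u *: xi) - (b' *: (G *m u) + betag *: (G *m xi)).
have uw : dot u w = dot u he - a' - b' * M.
  rewrite /w !dotBr !dotDr !dotZr u1 uM uxi uGxi; ring.
have Guw : dot (G *m u) w = beta - a' * M - b' * uG2u.
  rewrite /w /beta !dotBr !dotDr !dotZr !dot_Gam uM uGxi -/G -/uG2u; ring.
have -> : orth_coef u (G *m u) w = (uG2u * dot u he - M * beta) / alpha - a'.
  rewrite /orth_coef (gram_manifold hu) uw Guw dot_Gam.
  rewrite -/G uM -/uG2u -/alpha /alpha.
  by field.
have -> : orth_coef (G *m u) u w = (beta - M * dot u he) / alpha - b'.
  rewrite /orth_coef gramC (gram_manifold hu) uw Guw dot_Gam.
  rewrite -/G uM u1 -/uG2u -/alpha.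
  by rewrite /alpha; field.
apply/matrixP => i j; rewrite /w !mxE; ring.
Qed.
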